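(* Let $M$ be a ring. If a graph $G$ is connected and left $M$-homotens, then $G$ is chromatically $3$-connected.
   Context: Graphs are finite, with multiple edges and loops allowed, directed or undirected; connectivity, induced subgraphs and chromatic number of a directed graph refer to its underlying undirected graph. A graph $G$ is chromatically $k$-connected if for every $U\subseteq V(G)$ such that $G-U$ is disconnected, the induced subgraph $G[U]$ has chromatic number at least $k$. A ring is associative with unity. A circuit is a connected subgraph in which every vertex is incident with exactly two edge-ends; for directed graphs $C^+$/$C^-$ are its edges traversed forwards/backwards. An $M$-tension on a directed graph $D$ is $\tau:E(D)\to M$ with $\sum_{C^+}\tau=\sum_{C^-}\tau$ for every circuit $C$; $f:E(D)\to E(D')$ is $M$-tension-continuous ($TT_M$) if $\tau\circ f$ is an $M$-tension for every $M$-tension $\tau$ on $D'$ (for undirected graphs: for some orientations of both). A map $f$ is induced by a homomorphism $h$ if every edge $(u,v)$ is mapped to an edge from $h(u)$ to $h(v)$, and by an antihomomorphism $h$ if it is mapped to an edge from $h(v)$ to $h(u)$ (undirected: joining $h(u),h(v)$). $G$ is left $M$-homotens if for every loopless graph $H$ every $TT_M$ mapping from $G$ to $H$ is induced by a homomorphism or an antihomomorphism.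
   Formalization: The graph G is additionally assumed to have no loops; over a nonzero ring a graph with a loop has no TT_M mapping to a loopless graph, so it is vacuously left M-homotens and the claim fails (e.g. a path a-u-b with a loop at a). *)

(* Defs.v *)
From HB Require Import structures.
From mathcomp Require Import all_boot all_order all_algebra.

Set Implicit Arguments.
Unset Strict Implicit.
Unset Printing Implicit Defensive.

Import GRing.Theory.

(* Finite undirected multigraphs. [ends e] is the set of end-vertices of [e]:
   a singleton for a loop, a pair otherwise. *)
Record ugraph := UGraph {
  uvert : finType;
  uedge : finType;
  ends : uedge -> {set uvert};
  endsP : forall e, 0 < #|ends e| <= 2 }.

(* Finite directed multigraphs. *)
Record digraph := DiGraph {
  vert : finType;
  edge : finType;
  src : edge -> vert;
  tgt : edge -> vert }.

Lemma underlying_endsP (D : digraph) (e : edge D) :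
  0 < #|[set src e; tgt e]| <= 2.
Proof. by rewrite cards2; case: (_ != _). Qed.

Definition underlying (D : digraph) : ugraph := UGraph (@underlying_endsP D).

Definition uloopless (G : ugraph) : Prop := forall e : uedge G, #|ends e| = 2.

Definition loopless (D : digraph) : Prop := uloopless (underlying D).

(* A subgraph of [G] is given by a vertex set [W] and an edge set [F]. *)
Definition is_subgraph (G : ugraph) (W : {set uvert G}) (F : {set uedge G}) :=
  forall e, e \in F -> ends e \subset W.

Definition sub_adj (G : ugraph) (F : {set uedge G}) : rel (uvert G) :=
  fun x y => [exists e in F, ends e == [set x; y]].

(* To be used when [is_subgraph W F], so that paths along [F] from a vertex of
   [W] remain in [W]. The graph without vertices counts as connected. *)
Definition sub_connected (G : ugraph) (W : {set uvert G}) (F : {set uedge G}) :=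
  forall x y, x \in W -> y \in W -> connect (sub_adj F) x y.

Definition induced_edges (G : ugraph) (U : {set uvert G}) : {set uedge G} :=
  [set e | ends e \subset U].

Definition induced_connected (G : ugraph) (U : {set uvert G}) : Prop :=
  sub_connected U (induced_edges U).

Definition connected (G : ugraph) : Prop := induced_connected [set: uvert G].

(* [G[U]] has a proper colouring with colours [0, ..., c - 1]; taking [x = y],
   this fails for every [c] when [G[U]] has a loop. *)
Definition induced_colorable (G : ugraph) (U : {set uvert G}) (c : nat) : Prop :=
  exists col : uvert G -> nat,
    (forall x, x \in U -> col x < c) /\
    (forall e x y, e \in induced_edges U -> ends e = [set x; y] ->
       col x <> col y).

(* The chromatic number of [G[U]] is the least [c] (infinite if there is none)
   such that [G[U]] is [c]-colourable. *)
Definition chromatic_number_ge (G : ugraph) (U : {set uvert G}) (k : nat) : Prop :=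
  forall c, induced_colorable U c -> k <= c.

Definition chromatically_connected (k : nat) (G : ugraph) : Prop :=
  forall U : {set uvert G},
    ~ induced_connected (~: U) -> chromatic_number_ge U k.

(* The number of edge-ends in [F] at [v]; a loop at [v] contributes 2. *)
Definition edge_ends (D : digraph) (F : {set edge D}) (v : vert D) : nat :=
  #|[set e in F | src e == v]| + #|[set e in F | tgt e == v]|.

Definition circuit (D : digraph) (W : {set vert D}) (F : {set edge D}) : Prop :=
  [/\ W != set0,
      is_subgraph (G := underlying D) W F,
      sub_connected (G := underlying D) W F
    & forall v, v \in W -> edge_ends F v = 2].

(* [P] and [N] are the edges of the circuit [(W, F)] traversed forwards and
   backwards, for one of its two directions of traversal: walking along the
   circuit, each vertex is entered exactly once and left exactly once. *)
Definition traversal (D : digraph) (W : {set vert D}) (F P N : {set edge D}) : Prop :=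
  [/\ P :|: N = F,
      [disjoint P & N],
      forall v, v \in W ->
        #|[set e in P | tgt e == v]| + #|[set e in N | src e == v]| = 1
    & forall v, v \in W ->
        #|[set e in P | src e == v]| + #|[set e in N | tgt e == v]| = 1].

Local Open Scope ring_scope.

Definition tension (M : pzRingType) (D : digraph) (tau : edge D -> M) : Prop :=
  forall (W : {set vert D}) (F P N : {set edge D}),
    circuit W F -> traversal W F P N ->
    \sum_(e in P) tau e = \sum_(e in N) tau e.

Definition tension_continuous (M : pzRingType) (D D' : digraph)
    (f : edge D -> edge D') : Prop :=
  forall tau : edge D' -> M, tension tau -> tension (tau \o f).

Definition induced_by_hom (D D' : digraph) (f : edge D -> edge D')
    (h : vert D -> vert D') : Prop :=
  forall e, src (f e) = h (src e) /\ tgt (f e) = h (tgt e).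

Definition induced_by_antihom (D D' : digraph) (f : edge D -> edge D')
    (h : vert D -> vert D') : Prop :=
  forall e, src (f e) = h (tgt e) /\ tgt (f e) = h (src e).

Definition left_homotens (M : pzRingType) (D : digraph) : Prop :=
  forall (D' : digraph) (f : edge D -> edge D'),
    loopless D' -> tension_continuous M f ->
    (exists h, induced_by_hom f h) \/ (exists h, induced_by_antihom f h).

(* An orientation of [G] assigns to each edge its source and its target. *)
Definition orientation (G : ugraph) (o : uedge G -> uvert G * uvert G) : Prop :=
  forall e, ends e = [set (o e).1; (o e).2].

Definition oriented (G : ugraph) (o : uedge G -> uvert G * uvert G) : digraph :=
  @DiGraph (uvert G) (uedge G) (fun e => (o e).1) (fun e => (o e).2).

Definition utension_continuous (M : pzRingType) (G H : ugraph)
    (f : uedge G -> uedge H) : Prop :=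
  exists (o : uedge G -> uvert G * uvert G) (o' : uedge H -> uvert H * uvert H),
    [/\ orientation o, orientation o'
      & @tension_continuous M (oriented o) (oriented o') f].

(* For undirected graphs this is also "induced by an antihomomorphism". *)
Definition uinduced_by_hom (G H : ugraph) (f : uedge G -> uedge H)
    (h : uvert G -> uvert H) : Prop :=
  forall e, ends (f e) = h @: ends e.

Definition uleft_homotens (M : pzRingType) (G : ugraph) : Prop :=
  forall (H : ugraph) (f : uedge G -> uedge H),
    uloopless H -> utension_continuous M f -> exists h, uinduced_by_hom f h.

(* Main.v *)
(* Suppose that [U] separates a component [B] of [G - U] from the rest and that
   [G[U]] is bipartite. Identify each colour class of [U] to a single vertex;
   the resulting pair of vertices separates [B] from the rest, so a Whitney flip
   of the [B] side (exchanging the two vertices and reversing the edges) is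
   tension-continuous. It is not induced by a homomorphism, since that would
   force the flip to propagate along edges outside [B] through all of [G].
   The target is taken to be the complete digraph, where circuits of length 2
   and 3 suffice to write every tension as a potential difference. *)
Require Import Defs.
From HB Require Import structures.
From mathcomp Require Import all_boot all_order all_algebra.

Set Implicit Arguments.
Unset Strict Implicit.
Unset Printing Implicit Defensive.

Import GRing.Theory.

(** * Connectivity, orientations and fibre counts *)

Lemma sub_adj_sym (G : ugraph) (F : {set uedge G}) : symmetric (sub_adj F).
Proof. by move=> x y; apply: eq_existsb => e; rewrite setUC. Qed.

Lemma connected_closed (G : ugraph) (S : pred (uvert G)) :
  connected G ->
  (forall e x y, ends e = [set x; y] -> S x -> S y) ->
  forall x y, S x -> S y.
Proof.
move=> conG clS x y Sx.
have /connectP [p] := conG x y (in_setT _) (in_setT _).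
elim: p x Sx => [|z p IH] x Sx /=; first by move=> _ ->.
case/andP=> /existsP [e /andP [_ /eqP ends_e]]; apply: IH.
exact: clS ends_e Sx.
Qed.

Lemma orientation_exists (G : ugraph) :
  uloopless G -> exists o, orientation (G := G) o.
Proof.
move=> llG; apply: (@fin_all_exists _ _ (fun e p => ends e = [set p.1; p.2])).
move=> e; have /eqP/cards2P [x [y [_ ->]]] := llG e.
by exists (x, y).
Qed.

Lemma card_fiber_uniq (T T' : finType) (g : T -> T') (s : seq T) v :
  uniq (map g s) -> v \in map g s -> #|[set e in [set e in s] | g e == v]| = 1.
Proof.
elim: s => [|e0 s IH] //= /andP [ge0 us]; rewrite inE.
have [-> _ | neq /= vs] := eqVneq v (g e0).
  apply/eqP/cards1P; exists e0; apply/setP=> e; rewrite !inE.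
  have [-> | _ /=] := eqVneq e e0; first by rewrite eqxx.
  by apply/andP => -[es /eqP ge]; rewrite -ge map_f in ge0.
rewrite -(IH us vs); apply: eq_card => e; rewrite !inE.
by have [->|] := eqVneq e e0; rewrite //= eq_sym (negPf neq) andbF.
Qed.

Local Open Scope ring_scope.

(** * Tensions: potential differences and directed cycles *)

Lemma sum_fiber (M : nmodType) (V E : finType) (W : {set V}) (F : {set E})
    (g : E -> V) (p : V -> M) :
  (forall e, e \in F -> g e \in W) ->
  \sum_(e in F) p (g e) = \sum_(v in W) p v *+ #|[set e in F | g e == v]|.
Proof.
move=> gW; rewrite (partition_big g (fun v => v \in W)) //=.
apply: eq_bigr => v _; rewrite -sum1dep_card -sumrMnr.
by apply: eq_bigr => e /andP [_ /eqP ->]; rewrite mulr1n.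
Qed.

Lemma potential_tension (M : pzRingType) (D : digraph) (p : vert D -> M) :
  tension (fun e => p (tgt e) - p (src e)).
Proof.
move=> W F P N [_ subWF _ _] [PN _ ins outs].
have endsW e : e \in F -> (src e \in W) /\ (tgt e \in W).
  by move/subWF/subsetP=> sub; split; apply: sub; rewrite !inE eqxx ?orbT.
have PF e : e \in P -> e \in F by rewrite -PN inE => ->.
have NF e : e \in N -> e \in F by rewrite -PN inE orbC => ->.
(* With all signs positive, one side sums [p] over the vertices where the traversal enters and the
   other over those where it leaves; each vertex of [W] occurs once on either side. *)
apply/eqP; rewrite !sumrB subr_eq addrAC eq_sym subr_eq; apply/eqP.
have sum_once (A A' : {set edge D}) (g g' : edge D -> vert D) :
    (forall e, e \in A -> g e \in W) -> (forall e, e \in A' -> g' e \in W) ->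
    (forall v, v \in W -> #|[set e in A | g e == v]|
                         + #|[set e in A' | g' e == v]| = 1)%N ->
    \sum_(e in A) p (g e) + \sum_(e in A') p (g' e) = \sum_(v in W) p v.
  move=> gW g'W once; rewrite (sum_fiber _ gW) (sum_fiber _ g'W) -big_split /=.
  by apply: eq_bigr => v Wv; rewrite -mulrnDr once.
rewrite addrC (sum_once _ _ _ _ _ _ ins);
  try by move=> e; first [move/PF/endsW => [] | move/NF/endsW => []].
by rewrite (sum_once _ _ _ _ _ _ outs) // => e;
  first [move/PF/endsW => [] | move/NF/endsW => []].
Qed.

(** Each target is the next source. With [e1 := e0] this makes the targets along a closed walk a
    rotation of its sources. *)
Lemma map_tgt_path (D : digraph) (e0 e1 : edge D) (s : seq (edge D)) :
  path (fun e e' => tgt e == src e') e0 (rcons s e1) ->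
  map (@tgt D) (e0 :: s) = rcons (map (@src D) s) (src e1).
Proof.
by elim: s e0 => [|e s IH] e0 /= /andP [/eqP -> /=]; [|move/IH => /= ->].
Qed.

Lemma connect_path (D : digraph) (F : {set edge D}) e0 (s : seq (edge D)) e :
  path (fun e e' => tgt e == src e') e0 s -> {subset e0 :: s <= F} ->
  e \in e0 :: s ->
  connect (sub_adj (G := underlying D) F) (src e0) (src e).
Proof.
elim: s e0 => [|e1 s IH] e0 /= pth sF.
  by rewrite inE => /eqP ->.
case/andP: pth => /eqP t0 pth; rewrite inE => /orP [/eqP -> //|es].
apply: connect_trans (IH e1 pth _ es); last first.
  by move=> x xs; apply: sF; rewrite inE xs orbT.
apply/connect1/existsP; exists e0; rewrite -t0 eqxx andbT.
by apply: sF; rewrite mem_head.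
Qed.

(** Distinct sources make the closed walk a circuit all of whose edges are traversed forwards, so
    [P] is the whole edge set and [N] is empty. *)
Lemma directed_cycle_tension (M : pzRingType) (D : digraph)
    (tau : edge D -> M) (s : seq (edge D)) :
  tension tau -> uniq (map (@src D) s) ->
  cycle (fun e e' => tgt e == src e') s -> \sum_(e <- s) tau e = 0.
Proof.
case: s => [|e0 s] ten us cyc; first by rewrite big_nil.
set F := [set e in e0 :: s]; set W := [set v in map (@src D) (e0 :: s)].
have tgtE : perm_eq (map (@tgt D) (e0 :: s)) (map (@src D) (e0 :: s)).
  by rewrite (map_tgt_path cyc) perm_rcons.
have srcF v : v \in W -> #|[set e in F | src e == v]| = 1%N.
  by rewrite inE => Wv; apply: card_fiber_uniq.
have tgtF v : v \in W -> #|[set e in F | tgt e == v]| = 1%N.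
  rewrite inE -(perm_mem tgtE) => Wv; apply: card_fiber_uniq => //.
  by rewrite (perm_uniq tgtE).
have none (g : edge D -> vert D) v : #|[set e in set0 | g e == v]| = 0%N.
  by apply: eq_card0 => e; rewrite !inE.
have trav : traversal W F F set0.
  split; first exact: setU0.
  - by rewrite -setI_eq0 setI0.
  - by move=> v Wv; rewrite none tgtF.
  - by move=> v Wv; rewrite none srcF.
have circ : circuit W F.
  split.
  - by apply/set0Pn; exists (src e0); rewrite inE mem_head.
  - move=> e; rewrite inE => es; apply/subsetP => v; rewrite in_set2 in_set.
    by case/orP=> /eqP ->; [| rewrite -(perm_mem tgtE)]; apply: map_f.
  - have conn0 e : e \in e0 :: s ->
        connect (sub_adj (G := underlying D) F) (src e0) (src e).
      move=> es; apply: connect_path es; last by move=> x xs; rewrite in_set.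
      by move: cyc; rewrite /= rcons_path => /andP [].
    move=> x y; rewrite !in_set => /mapP [e es ->] /mapP [e' e's ->].
    apply: connect_trans (conn0 _ e's).
    by rewrite (sym_connect_sym (@sub_adj_sym _ _)); apply: conn0.
  - by move=> v Wv; rewrite /edge_ends srcF ?tgtF.
have := ten _ _ _ _ circ trav; rewrite big_set0; apply: etrans.
by rewrite big_uniq ?(map_uniq us) //; apply: eq_bigl => e; rewrite in_set.
Qed.

(** * The complete digraph and its potentials *)

Definition complete_digraph (T : finType) : digraph :=
  @DiGraph T {p : T * T | p.1 != p.2} (fun p => (val p).1) (fun p => (val p).2).

Lemma complete_digraph_loopless (T : finType) : loopless (complete_digraph T).
Proof. by move=> [p pE]; rewrite /= cards2 pE. Qed.

Lemma complete_digraph_potential (M : pzRingType) (T : finType) (x0 : T)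
    (tau : edge (complete_digraph T) -> M) :
  tension tau ->
  exists q : T -> M, forall e, tau e = q (tgt e) - q (src e).
Proof.
(* The potential at [x] is the tension of the edge from the base point [x0]; the default 0 occurs
   only at [x0] itself. *)
move=> ten; pose q x := if insub (x0, x) is Some e then tau e else 0.
have q0 : q x0 = 0 by rewrite /q insubN //= eqxx.
have qE x (ne : x0 != x) : q x = tau (exist _ (x0, x) ne) by rewrite /q insubT.
have qV y (ne : y != x0) : q y + tau (exist _ (y, x0) ne) = 0.
  have ne' := ne; rewrite eq_sym in ne'; rewrite qE.
  rewrite -[RHS](@directed_cycle_tension _ _ tau
    [:: exist _ (x0, y) ne'; exist _ (y, x0) ne]) //.
  - by rewrite !big_cons big_nil addr0.
  - by rewrite /= inE ne'.
  - by rewrite /= !eqxx.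
exists q => -[[x y] /= ne].
have [x0x | ne0x] := eqVneq x0 x; first by subst x; rewrite q0 subr0 qE.
have [yx0 | ney0] := eqVneq y x0.
  by subst y; apply/eqP; rewrite q0 sub0r -addr_eq0 addrC qV.
(* Adding the tension of the edge back to [x0] makes one side vanish by the 2-cycle relation [qV]
   and the other the sum over the triangle [x0], [x], [y]. *)
apply/eqP; rewrite eq_sym subr_eq -(inj_eq (addIr (tau (exist _ (y, x0) ney0)))).
rewrite qV -[X in X == _](@directed_cycle_tension _ _ tau
  [:: exist _ (x0, x) ne0x; exist _ (x, y) ne; exist _ (y, x0) ney0]) //.
- by rewrite !big_cons big_nil addr0 -qE [tau _ + q x]addrC addrA.
- by rewrite /= !inE negb_or ne0x ne eq_sym ney0.
- by rewrite /= !eqxx.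
Qed.

(** * The Whitney flip *)

(** The apices [inr true] and [inr false] are the two merged colour classes of [U]. *)
Definition contract (T : finType) (U : {set T}) (col : T -> bool) (v : T) :
  T + bool := if v \in U then inr (col v) else inl v.

Definition swap_apices (T : Type) (x : T + bool) : T + bool :=
  if x is inr b then inr (~~ b) else x.

Definition flip (T : finType) (B U : {set T}) (col : T -> bool) (x y : T) :
    (T + bool) * (T + bool) :=
  let c := contract U col in
  if (x \in B) || (y \in B) then (swap_apices (c y), swap_apices (c x))
  else (c x, c y).

Lemma swap_apices_inj (T : Type) : injective (@swap_apices T).
Proof. by move=> [x|[]] [y|[]] //= [->]. Qed.

(** A tension of the target has a potential [q], and its pullback has a potential [p]: it follows
    [q] outside [B], while on [B], where edges are reversed, it is a constant minus [q]. *)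
Lemma flip_tension_continuous (M : pzRingType) (D : digraph)
    (B U : {set vert D}) (col : vert D -> bool)
    (f : edge D -> edge (complete_digraph (vert D + bool)%type)) :
  [disjoint B & U] ->
  (forall e, src e \in B -> tgt e \in B :|: U) ->
  (forall e, tgt e \in B -> src e \in B :|: U) ->
  (forall e, val (f e) = flip B U col (src e) (tgt e)) ->
  tension_continuous M f.
Proof.
move=> disBU sB tB fE tau /(complete_digraph_potential (inr true)) [q tauE].
pose c := contract U col.
(* On [B :|: U] the two formulas agree at [U], because [swap_apices] exchanges
   the two apices. *)
pose p v := if v \in B then q (inr true) + q (inr false) - q (inl v) else q (c v).
have pE v : v \in B :|: U ->
    p v = q (inr true) + q (inr false) - q (swap_apices (c v)).
  rewrite inE /p /c /contract.
  have [vB _ | _ /= ->] := boolP (v \in B).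
    by rewrite (disjointFr disBU vB).
  by case: (col v); [rewrite addrK | rewrite [q (inr true) + _]addrC addrK].
suff eq_tau e : (tau \o f) e = p (tgt e) - p (src e).
  move=> W F P N circ trav.
  have := @potential_tension M D p W F P N circ trav.
  by under eq_bigr do rewrite -eq_tau; under [RHS]eq_bigr do rewrite -eq_tau.
rewrite /= tauE /= fE /flip -/c.
have [inB | /norP [sNB tNB]] := ifPn; last by rewrite /= /p (negPf sNB) (negPf tNB).
have [sBU tBU] : src e \in B :|: U /\ tgt e \in B :|: U.
  case/orP: inB => inB; first by rewrite sB // inE inB.
  by rewrite tB // inE inB.
by rewrite /= !pE // opprB [RHS]addrC addrA subrK.
Qed.

(** If [h] existed, a set [S] of vertices containing [b] but not [a] would be closed under
    adjacency, against connectivity. *)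
Lemma flip_not_hom (G : ugraph) (B U : {set uvert G}) (col : uvert G -> bool)
    (h : uvert G -> uvert G + bool) b a :
  connected G -> [disjoint B & U] ->
  (forall e x y, ends e = [set x; y] -> x \in B -> y \in B :|: U) ->
  b \in B -> a \notin B :|: U ->
  ~ (forall e x y, ends e = [set x; y] ->
       [set h x; h y]
       = [set (flip B U col x y).1; (flip B U col x y).2]).
Proof.
move=> conG disBU sepB bB; rewrite inE => /norP [aB aU] hE.
pose c := contract U col.
(* The last clause takes in the vertices of [U] with all neighbours in [B]: their image under [h]
   need not be an apex, but no edge leads from them out of [B]. *)
pose S v := [|| v \in B, (v \in U) && (h v == swap_apices (c v)) |
  (v \in U) && [forall e, forall w, (ends e == [set v; w]) ==> (w \in B)]].
suff clS e s t : ends e = [set s; t] -> S s -> S t.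
  have := connected_closed conG clS (x := b) a.
  by rewrite /S bB (negPf aB) (negPf aU) /= => /(_ isT).
have cU v : v \in U -> c v = inr (col v) by rewrite /c /contract => ->.
have hNB e' x y : ends e' = [set x; y] -> x \notin B -> y \notin B ->
    [set h x; h y] = [set c x; c y].
  by move=> E xB yB; rewrite (hE _ _ _ E) /flip (negPf xB) (negPf yB).
move=> E; have [tB | tB] := boolP (t \in B); first by rewrite /S tB.
case/or3P => [sB | /andP [sU /eqP hs] | /andP [_ /forallP /(_ e)]].
- have tU : t \in U by have := sepB _ _ _ E sB; rewrite inE (negPf tB).
  have [allB | ] :=
      boolP [forall e', forall w, (ends e' == [set t; w]) ==> (w \in B)].
    by rewrite /S tU allB !orbT.
  case/forallPn => e' /forallPn [w]; rewrite negb_imply => /andP [/eqP E' wB].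
  suff /eqP ht : h t == swap_apices (c t) by rewrite /S tU ht eqxx orbT.
  (* The flipped edge [e] leaves [h t] only the swapped apex or [inl s]; the unflipped edge [e'],
     whose end [w] is outside [B], rules out [inl s]. *)
  have cs : c s = inl s by rewrite /c /contract (disjointFr disBU sB).
  have : h t \in [set c t; c w] by rewrite -(hNB _ _ _ E') // !inE eqxx.
  have : h t \in [set h s; h t] by rewrite !inE eqxx orbT.
  rewrite (hE _ _ _ E) /flip sB /= -/c cs !inE => /orP [// | /eqP ->].
  rewrite cU // /c /contract; case: ifP => // _ /= /eqP [sw].
  by rewrite -sw sB in wB.
- have sB : s \notin B by rewrite (disjointFl disBU sU).
  (* As [h s] is the apex opposite to [c s], it must be [c t]. So [t] lies in the other colour
     class, and [h t] is [c s], the swap of [c t]. *)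
  have hst := hNB _ _ _ E sB tB.
  have : h s \in [set c s; c t] by rewrite -hst !inE eqxx.
  have : c s \in [set h s; h t] by rewrite hst !inE eqxx.
  rewrite !inE hs (cU s) //= => /orP [|/eqP ht]; first by case: (col s).
  case/orP => [|/eqP ct]; first by case: (col s).
  have tU : t \in U by move: ct; rewrite /c /contract; case: ifP.
  by rewrite /S tU -ht -ct /= negbK eqxx orbT.
- by move=> /forallP /(_ t); rewrite E eqxx (negPf tB).
Qed.

(** Properness of the colouring keeps edges inside [U] from collapsing to loops, so the flip lands
    in the complete digraph. *)
Lemma flip_neq (T : finType) (B U : {set T}) (col : T -> bool) x y :
  x != y -> (x \in U -> y \in U -> col x != col y) ->
  (flip B U col x y).1 != (flip B U col x y).2.
Proof.
move=> xy colxy; rewrite /flip.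
have cxy : contract U col x != contract U col y.
  rewrite /contract; case: ifP => xU; case: ifP => yU //.
  by apply: contraNneq (colxy xU yU) => -[->].
by case: ifP => _ //=; rewrite (inj_eq (@swap_apices_inj _)) eq_sym.
Qed.

Lemma flip_ends_sym (T : finType) (B U : {set T}) (col : T -> bool) x y :
  [set (flip B U col x y).1; (flip B U col x y).2]
  = [set (flip B U col y x).1; (flip B U col y x).2].
Proof. by rewrite /flip [(y \in B) || _]orbC setUC; case: ifP. Qed.

Lemma set2_eq (T : finType) (x y z t : T) :
  [set x; y] = [set z; t] -> (x = z /\ y = t) \/ (x = t /\ y = z).
Proof.
move=> E.
have: x \in [set z; t] by rewrite -E set21.
have: y \in [set z; t] by rewrite -E set22.
have: z \in [set x; y] by rewrite E set21.
have: t \in [set x; y] by rewrite E set22.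
rewrite !inE => /orP [] /eqP -> /orP [] /eqP -> /orP [] /eqP ? /orP [] /eqP ?;
  subst; by [left | right].
Qed.

(** * Deduction of both versions of the theorem *)

(** Common core of the directed and undirected cases: one orientation is fixed, and [h] only has to
    respect unordered ends. *)
Lemma chromatically_3_connected (M : pzRingType) (G : ugraph)
    (o : uedge G -> uvert G * uvert G) :
  orientation o -> uloopless G -> connected G ->
  (forall f : uedge G ->
      uedge (underlying (complete_digraph (uvert G + bool)%type)),
    @tension_continuous M (oriented o) (complete_digraph _) f ->
    exists h, uinduced_by_hom f h) ->
  chromatically_connected 3 G.
Proof.
move=> oo llG conG homs U disc k [col [colk colU]].
rewrite leqNgt; apply/negP => k2; apply: disc => a b.
rewrite !inE => aU bU; apply/negPn/negP => nab.
pose r := sub_adj (induced_edges (~: U)).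
pose B := [set z in ~: U | connect r a z].
have disBU : [disjoint B & U].
  by apply/pred0P=> z; rewrite /= !inE; case: (z \in U); rewrite ?andbF.
have sepB e x y : ends e = [set x; y] -> x \in B -> y \in B :|: U.
  move=> E; rewrite !inE => /andP [xU ax].
  have [//|yU /=] := boolP (y \in U); rewrite ?orbT // orbF.
  apply: connect_trans ax (connect1 _); apply/existsP; exists e.
  rewrite inE E eqxx andbT; apply/subsetP => z.
  by rewrite !inE => /orP [] /eqP ->.
have aB : a \in B by rewrite !inE aU connect0.
have bBU : b \notin B :|: U by rewrite !inE bU /= negb_or bU andbT.
(* At most two colours occur on [U], so testing for colour 0 tells them apart. *)
pose colb v := col v == 0%N.
have ne e : (flip B U colb (o e).1 (o e).2).1 != (flip B U colb (o e).1 (o e).2).2.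
  apply: flip_neq => [|sU tU].
    by have := llG e; rewrite oo cards2; case: (_ != _).
  have := colU e _ _ _ (oo e); rewrite inE oo.
  have -> : [set (o e).1; (o e).2] \subset U.
    by apply/subsetP=> z; rewrite !inE => /orP [] /eqP ->.
  have := leq_trans (colk _ sU) k2; have := leq_trans (colk _ tU) k2.
  rewrite /colb; case: (col (o e).1) => [|[|//]]; case: (col (o e).2) => [|[|//]] //=.
    by move=> _ _ /(_ isT) [].
  by move=> _ _ /(_ isT) [].
pose f e : uedge (underlying (complete_digraph (uvert G + bool)%type)) :=
  exist _ (flip B U colb (o e).1 (o e).2) (ne e).
have [] := homs f.
  apply: (@flip_tension_continuous M (oriented o) B U colb f) => //= e.
    exact: sepB (oo e).
  by apply: (sepB e); rewrite setUC - oo.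
move=> h hf; apply: (@flip_not_hom G B U colb h a b) => // e x y E.
have <- : h @: ends e = [set h x; h y] by rewrite E imsetU !imset_set1.
rewrite -hf /=; have : [set (o e).1; (o e).2] = [set x; y] by rewrite - oo.
by case/set2_eq => -[-> ->] //; apply: flip_ends_sym.
Qed.

Theorem theorem27 (M : pzRingType) :
  (forall D : digraph,
     loopless D ->
     connected (underlying D) -> left_homotens M D ->
     chromatically_connected 3 (underlying D)) /\
  (forall G : ugraph,
     uloopless G ->
     connected G -> uleft_homotens M G ->
     chromatically_connected 3 G).
Proof.
split=> [[V E s t] ll con homt | G ll con homt].
  apply: (@chromatically_3_connected M (underlying (DiGraph s t))
    (fun e => (s e, t e)) _ ll con) => // f contf.
  (* A homomorphism and an antihomomorphism yield the same unordered ends. *)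
  have [] := homt _ f (@complete_digraph_loopless _) contf => -[h hf];
    exists h => e; have [/= -> ->] := hf e.
    by rewrite imsetU !imset_set1.
  by rewrite imsetU !imset_set1 setUC.
have [o oo] := orientation_exists ll.
apply: (chromatically_3_connected (M := M) oo) => // f contf.
apply: homt; first exact: complete_digraph_loopless.
by exists o, (fun e => (src e, tgt e)).
Qed.
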